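(* Let $\mathbf{F}\in[L^2(\mathbb{R}^2)]^2$ have compact support $\Omega$ (a bounded domain), fix $\mathbf{z}\in\mathbb{R}^2\setminus\overline\Omega$, let $\mathcal{T}=\{\tau_1,\tau_2,\tau_3\}$ be three different complex numbers with $\tau_2-\tau_1$, $\tau_3-\tau_1$ linearly independent over $\mathbb{R}$, fix $\hat{\mathbf{x}}_0\in\mathbb{S}$ and choose $\mathbf{q}_0\in\mathbb{S}$ with $\mathbf{q}_0\cdot\hat{\mathbf{x}}_0\neq0$. If the set $$\{\alpha\in\mathbb{R}:\ \Pi_\alpha\subset S_\Omega(\hat{\mathbf{x}}_0),\ f_{\hat{\mathbf{x}}_0}(\alpha)=0\}$$ has Lebesgue measure zero, then the strip $S_\Omega(\hat{\mathbf{x}}_0)$ is uniquely determined by the phaseless data set $$\mathcal{E}_p=\{|u^\infty_{\mathbf{F}\cup\{\mathbf{z}\},p}(\hat{\mathbf{x}}_0,\mathbf{q}_0,\omega,\tau)|:\ \omega\in\mathbb{W},\ \tau\in\mathcal{T}\}.$$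
   Context: $\mathbb{W}=(\omega_{min},\omega_{max})$, $0<\omega_{min}<\omega_{max}$; Lamé constants $\mu>0$, $2\mu+\lambda>0$; $k_p=\omega/\sqrt{\lambda+2\mu}$. $\mathbb{S}$ is the unit circle. The compressional far field of the source is $u^\infty_{\mathbf{F},p}(\hat{\mathbf{x}},\omega)=\int_{\mathbb{R}^2}e^{-ik_p\hat{\mathbf{x}}\cdot\mathbf{y}}\hat{\mathbf{x}}\cdot\mathbf{F}(\mathbf{y})d\mathbf{y}$, and with an added point source at $\mathbf{z}$ with strength $\tau$ and polarization $\mathbf{q}$: $u^\infty_{\mathbf{F}\cup\{\mathbf{z}\},p}(\hat{\mathbf{x}},\mathbf{q},\omega,\tau)=u^\infty_{\mathbf{F},p}(\hat{\mathbf{x}},\omega)+\tau e^{-ik_p\hat{\mathbf{x}}\cdot\mathbf{z}}\,\mathbf{q}\cdot\hat{\mathbf{x}}$. The $\hat{\mathbf{x}}$-strip hull is $S_\Omega(\hat{\mathbf{x}})=\{\mathbf{y}\in\mathbb{R}^2:\ \inf_{\mathbf{w}\in\Omega}\mathbf{w}\cdot\hat{\mathbf{x}}\le\mathbf{y}\cdot\hat{\mathbf{x}}\le\sup_{\mathbf{w}\in\Omega}\mathbf{w}\cdot\hat{\mathbf{x}}\}$. For $\alpha\in\mathbb{R}$, $\Pi_\alpha=\{\mathbf{y}\in\mathbb{R}^2:\ \mathbf{y}\cdot\hat{\mathbf{x}}_0+\alpha=0\}$ and $f_{\hat{\mathbf{x}}_0}(\alpha)=\int_{\Pi_\alpha}\hat{\mathbf{x}}_0\cdot\mathbf{F}(\mathbf{y})\,ds(\mathbf{y})$.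 *)

(* Defs.v *)
From HB Require Import structures.
From mathcomp Require Import all_boot all_order all_algebra.
From mathcomp Require Import all_classical all_reals all_analysis.
From mathcomp Require Import complex.
Set Implicit Arguments. Unset Strict Implicit. Unset Printing Implicit Defensive.
Import Order.TTheory GRing.Theory Num.Theory.
Import numFieldNormedType.Exports.
Local Open Scope ring_scope.
Local Open Scope classical_set_scope.
Local Open Scope complex_scope.

Section Defs.
Variable R : realType.

Definition dot2 (a b : R * R) : R := a.1 * b.1 + a.2 * b.2.

Definition dotc (x : R * R) (v : R[i] * R[i]) : R[i] := x.1%:C * v.1 + x.2%:C * v.2.

Definition unit_circle (x : R * R) : Prop := dot2 x x = 1.

Definition leb2 := product_measure1 (@lebesgue_measure R) (@lebesgue_measure R).

Definition cexpi (theta : R) : R[i] := (cos theta)%:C + 'i * (sin theta)%:C.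

Definition cint d (T : measurableType d) (m : {measure set T -> \bar R}) (D : set T)
  (g : T -> R[i]) : R[i] :=
  (Rintegral m D (fun t => complex.Re (g t)))%:C + 'i * (Rintegral m D (fun t => complex.Im (g t)))%:C.

Definition cL2 (g : R * R -> R[i]) : Prop :=
  measurable_fun setT (fun y => complex.Re (g y)) /\ measurable_fun setT (fun y => complex.Im (g y)) /\
  (\int[leb2]_y ((complex.Re (g y)) ^+ 2 + (complex.Im (g y)) ^+ 2)%:E < +oo)%E.

Definition vL2 (F : R * R -> R[i] * R[i]) : Prop :=
  cL2 (fun y => (F y).1) /\ cL2 (fun y => (F y).2).

Definition bounded_domain (Om : set (R * R)) : Prop :=
  Om !=set0 /\ open Om /\ connected Om /\
  exists M : R, forall w, Om w -> `|w.1| <= M /\ `|w.2| <= M.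

Definition kp (lam mu omega : R) : R := omega / Num.sqrt (lam + 2 * mu).

Definition farfield_p (lam mu : R) (F : R * R -> R[i] * R[i]) (x : R * R) (omega : R) : R[i] :=
  cint leb2 setT (fun y => cexpi (- (kp lam mu omega * dot2 x y)) * dotc x (F y)).

(* compressional far field of F together with a point source at z, strength tau,
   polarization q *)
Definition farfield_p_pt (lam mu : R) (F : R * R -> R[i] * R[i]) (z : R * R)
  (x q : R * R) (omega : R) (tau : R[i]) : R[i] :=
  farfield_p lam mu F x omega
  + tau * cexpi (- (kp lam mu omega * dot2 x z)) * (dot2 q x)%:C.

Definition strip_hull (Om : set (R * R)) (x : R * R) : set (R * R) :=
  [set y | inf [set dot2 w x | w in Om] <= dot2 y x <= sup [set dot2 w x | w in Om]].

Definition Pi_line (x0 : R * R) (alpha : R) : set (R * R) :=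
  [set y | dot2 y x0 + alpha = 0].

(* f_{x0}(alpha) = int_{Pi_alpha} x0 . F(y) ds(y), using the arc-length
   parametrization y = -alpha x0 + t x0^perp, x0^perp = (-x0.2, x0.1), t in R
   (for |x0| = 1). *)
Definition f_proj (F : R * R -> R[i] * R[i]) (x0 : R * R) (alpha : R) : R[i] :=
  cint (@lebesgue_measure R) setT
    (fun t => dotc x0 (F (- alpha * x0.1 - t * x0.2, - alpha * x0.2 + t * x0.1))).

End Defs.

(* Main.v *)
(* Writing [w_j] for the far fields divided by the point source factor, the data are
   the distances of [w_1] and [w_2] to three points that are not collinear, so the
   phased far fields coincide for all frequencies in a band. Rotating coordinates,
   the far field at wave number [k] is the one-dimensional Fourier transform of the
   line integrals [f_proj F x0]. These vanish outside a bounded interval, so after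
   modulation to the middle of the band the difference of the two has vanishing
   low-frequency trigonometric integrals, hence vanishing moments, hence vanishing
   integrals over all intervals, and is 0 almost everywhere by Lebesgue's
   differentiation theorem. If the strips were different, there would be an interval
   of lines inside one strip and outside the other; on almost all of these the line
   integral of the first source is 0, contrary to the hypothesis. *)
Require Import Defs.
From HB Require Import structures.
From mathcomp Require Import all_boot all_order all_algebra.
From mathcomp Require Import all_classical all_reals all_analysis.
From mathcomp Require Import measurable_realfun complex ring lra.
Set Implicit Arguments. Unset Strict Implicit. Unset Printing Implicit Defensive.
Import Order.TTheory GRing.Theory Num.Theory.
Import numFieldNormedType.Exports.
Local Open Scope ring_scope.
Local Open Scope classical_set_scope.
Local Open Scope complex_scope.

(** * Integrals against bounded multipliers and passage to the limit *)

Section vanishing_integrals.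
Context {d : measure_display} {T : measurableType d} {R : realType}.
Variable mu : {measure set T -> \bar R}.
Implicit Types f h : T -> R.

(** The bound on [h] is asked only where [f] does not vanish, so that polynomials are admissible
    multipliers when [f] has bounded support. *)
Lemma integrable_bddM h f (C : R) : measurable_fun setT h ->
  (forall x, f x != 0 -> `|h x| <= C) ->
  mu.-integrable setT (EFin \o f) -> mu.-integrable setT (EFin \o (h \* f)).
Proof.
move=> mh hC fi; have mf := measurable_int _ fi.
apply: (@le_integrable _ _ _ mu setT measurableT _ (fun x => C%:E * (EFin \o f) x)%E).
- apply/measurable_EFinP; apply: measurable_funM => //.
  by move/measurable_EFinP : mf.
- move=> x _ /=; rewrite lee_fin !normrM.
  have [->|/hC hx] := eqVneq (f x) 0; first by rewrite normr0 !mulr0.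
  by rewrite ler_wpM2r// (le_trans hx)// ler_norm.
- exact: integrableZl.
Qed.

(** Dominated convergence with majorant [|C| * |f|]. It serves twice: for powers of difference
    quotients of the sine, and for polynomial approximations of an indicator. *)
Lemma dominated_Rintegral_eq0 (h_ : nat -> T -> R) h f (C : R) :
  (forall n, measurable_fun setT (h_ n)) -> measurable_fun setT h ->
  (forall n x, f x != 0 -> `|h_ n x| <= C) ->
  {ae mu, forall x, f x != 0 -> h_ n x @[n --> \oo] --> h x} ->
  mu.-integrable setT (EFin \o f) ->
  (forall n, \int[mu]_x (h_ n x * f x) = 0) -> \int[mu]_x (h x * f x) = 0.
Proof.
move=> mh_ mh hC cvh fi I0; have /measurable_EFinP mf := measurable_int _ fi.
have [] := @dominated_convergence _ _ _ mu setT measurableT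
  (fun n => EFin \o (h_ n \* f)) (EFin \o (h \* f))
  (fun x => (`|C|%:E * (EFin \o (Num.norm \o f)) x)%E).
- by move=> n; apply/measurable_EFinP; exact: measurable_funM.
- by apply/measurable_EFinP; exact: measurable_funM.
- apply: filterS cvh => x cvx _; apply: cvg_EFin; first exact: nearW.
  have [fx0|/cvx fx0] := eqVneq (f x) 0.
    by rewrite /comp /= fx0 mulr0; under eq_fun do rewrite mulr0; exact: cvg_cst.
  exact: (cvgM fx0 (cvg_cst _)).
- exact/integrableZl/integrable_norm.
- apply: aeW => x n _ /=; rewrite lee_fin normrM.
  have [->|/(hC n) hx] := eqVneq (f x) 0; first by rewrite normr0 !mulr0.
  by rewrite ler_wpM2r// (le_trans hx)// ler_norm.
move=> _ _; rewrite /Rintegral => cvI.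
rewrite (_ : (fun _ => _) = fun=> 0%E) in cvI.
  by rewrite (cvg_unique _ cvI (cvg_cst 0%E)).
(* [Rintegral] sends infinite integrals to 0 through [fine]; integrability is what turns [I0] into a
   true zero in the extended reals. *)
apply/funext => n; have := I0 n; rewrite /Rintegral => I0n.
rewrite -[LHS]fineK ?I0n//; apply: integrable_fin_num => //.
exact: (integrable_bddM (mh_ n) (hC n)).
Qed.

End vanishing_integrals.

(** * Elementary bounds and limits for sine and cosine *)

Section trigonometric_bounds.
Context {R : realType}.
Implicit Types s t : R.

Lemma norm_sin_le t : `|sin t| <= `|t|.
Proof.
wlog t0 : t / 0 <= t.
  have [t0|t0] := leP 0 t; first exact.
  by move=> /(_ (- t)); rewrite sinN !normrN; apply; rewrite oppr_ge0 ltW.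
have [|c _] := @MVT_segment R sin cos 0 t t0 (fun x _ => is_derive_sin x).
  exact/continuous_subspaceT/continuous_sin.
rewrite sin0 !subr0 => ->; rewrite normrM ler_piMl//; exact: cos_max.
Qed.

(** These are difference quotients at 0 of [x |-> sin (x * s)], whose derivative there is [s]. *)
Lemma cvg_sinM_div (u : nat -> R) s : (forall n, u n != 0) ->
  u n @[n --> \oo] --> 0 -> sin (u n * s) / u n @[n --> \oo] --> s.
Proof.
move=> u0 cvu.
have dsin : is_derive (0 : R) 1 (fun x => sin (x * s)) s.
  apply: is_derive_eq; rewrite mul0r cos0 scale0r add0r mul1r.
  exact: mulr1.
have /cvgr_dnbhsP : h^-1 *: (((fun x => sin (x * s)) \o shift 0) (h *: 1)
    - sin (0 * s)) @[h --> 0^'] --> s.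
  by rewrite -[X in _ --> X](@derive_val _ _ _ _ _ _ _ dsin); exact: ex_derive.
move=> /(_ u (conj u0 cvu)); apply: cvg_trans; apply: near_eq_cvg.
apply: nearW => n /=; rewrite mul0r sin0 subr0 addr0 /GRing.scale/= mulr1.
by rewrite mulrC.
Qed.

Lemma measurable_sinM (a : R) : measurable_fun setT (fun s => sin (a * s)).
Proof.
apply: continuous_measurable_fun => s.
by apply: continuous_comp; [exact: mulrl_continuous|exact: continuous_sin].
Qed.

Lemma measurable_cosM (a : R) : measurable_fun setT (fun s => cos (a * s)).
Proof.
apply: continuous_measurable_fun => s.
by apply: continuous_comp; [exact: mulrl_continuous|exact: continuous_cos].
Qed.

End trigonometric_bounds.

(** * From vanishing low frequencies to vanishing moments *)

Section low_frequencies.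
Context {R : realType}.
Notation mu := (@lebesgue_measure R).
Variables (f : R -> R) (delta : R).
Hypothesis fi : mu.-integrable setT (EFin \o f).
Hypothesis cos_eq0 : forall h, `|h| < delta -> \int[mu]_s (cos (h * s) * f s) = 0.
Hypothesis sin_eq0 : forall h, `|h| < delta -> \int[mu]_s (sin (h * s) * f s) = 0.

Let int_sinXcos n (h k : R) :
  mu.-integrable setT (EFin \o (fun s => sin (h * s) ^+ n * cos (k * s) * f s)).
Proof.
apply: (@integrable_bddM _ _ _ mu (fun s => sin (h * s) ^+ n * cos (k * s)) f 1) => //.
  apply: measurable_funM; last exact: measurable_cosM.
  by apply: measurable_funX; exact: measurable_sinM.
move=> s _; rewrite normrM normrX mulr_ile1 ?cos_max// exprn_ile1//.
exact: sin_max.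
Qed.

Let int_sinXsin n (h k : R) :
  mu.-integrable setT (EFin \o (fun s => sin (h * s) ^+ n * sin (k * s) * f s)).
Proof.
apply: (@integrable_bddM _ _ _ mu (fun s => sin (h * s) ^+ n * sin (k * s)) f 1) => //.
  apply: measurable_funM; last exact: measurable_sinM.
  by apply: measurable_funX; exact: measurable_sinM.
move=> s _; rewrite normrM normrX mulr_ile1 ?sin_max// exprn_ile1//.
exact: sin_max.
Qed.

(* The product-to-sum formulas trade a factor [sin (h * s)] for the two shifted
   frequencies [h + k] and [h - k], which stay below [delta]. *)
Lemma Rintegral_sinX_eq0 n (h k : R) : `|k| + n%:R * `|h| < delta ->
  \int[mu]_s (sin (h * s) ^+ n * cos (k * s) * f s) = 0 /\
  \int[mu]_s (sin (h * s) ^+ n * sin (k * s) * f s) = 0.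
Proof.
elim: n k => [|n IH] k.
  rewrite mul0r addr0 => kd; split.
    by under eq_Rintegral do rewrite expr0 mul1r; exact: cos_eq0.
  by under eq_Rintegral do rewrite expr0 mul1r; exact: sin_eq0.
rewrite -natr1 mulrDl mul1r => kd.
have hkD : `|h + k| + n%:R * `|h| < delta.
  by have := ler_normD h k; move: kd; lra.
have hkB : `|h - k| + n%:R * `|h| < delta.
  by have := ler_normB h k; move: kd; lra.
have [cD sD] := IH _ hkD; have [cB sB] := IH _ hkB.
split.
- transitivity (\int[mu]_s (2^-1 * (sin (h * s) ^+ n * sin ((h + k) * s) * f s
      + sin (h * s) ^+ n * sin ((h - k) * s) * f s))).
    apply: eq_Rintegral => s _; rewrite exprSr (mulrDl h k) (mulrBl s h k).
    rewrite (sinD (h * s) (k * s)) sinB.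
    by field.
  rewrite RintegralZl//; last exact: (integrableD _ (int_sinXsin _ _ _) (int_sinXsin _ _ _)).
  by rewrite RintegralD// sD sB addr0 mulr0.
- transitivity (\int[mu]_s (2^-1 * (sin (h * s) ^+ n * cos ((h - k) * s) * f s
      - sin (h * s) ^+ n * cos ((h + k) * s) * f s))).
    apply: eq_Rintegral => s _; rewrite exprSr (mulrDl h k) (mulrBl s h k).
    rewrite (cosD (h * s) (k * s)) cosB.
    by field.
  rewrite RintegralZl//; last exact: (integrableB _ (int_sinXcos _ _ _) (int_sinXcos _ _ _)).
  by rewrite RintegralB// cD cB subr0 mulr0.
Qed.

Variable M : R.
Hypothesis fM : forall s, M < `|s| -> f s = 0.

Let fM' s : f s != 0 -> `|s| <= M.
Proof. by rewrite leNgt; apply: contraNN => /fM ->. Qed.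

(* [(sin (h * s) / h) ^+ n] tends to [s ^+ n] as [h] tends to 0. *)
Lemma Rintegral_moment_eq0 n : 0 < delta -> \int[mu]_s (s ^+ n * f s) = 0.
Proof.
(* The factor [delta / n.+1%:R] keeps [n%:R * u m] below [delta] for every [m], as
   [Rintegral_sinX_eq0] requires for the [n]-th power of the sine. *)
move=> d0; pose u (m : nat) := delta / n.+1%:R * m.+1%:R^-1.
have u0 m : 0 < u m by rewrite /u divr_gt0// divr_gt0.
have cvu : u m @[m --> \oo] --> 0.
  by rewrite -(mulr0 (delta / n.+1%:R)); apply: cvgMl_tmp; exact: cvg_harmonic.
apply: (@dominated_Rintegral_eq0 _ _ _ mu
  (fun m s => (sin (u m * s) / u m) ^+ n) _ _ (M ^+ n)) => //.
- move=> m; apply: measurable_funX; apply: measurable_funM => //.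
  exact: measurable_sinM.
(* Since [|sin t| <= |t|], each quotient is at most [|s|], which is at most [M] on the support of
   [f]. *)
- move=> m s /fM' sM; rewrite normrX lerXn2r ?nnegrE//.
    exact: le_trans sM.
  rewrite (le_trans _ sM)// normrM normfV ler_pdivrMr ?normr_gt0 ?gt_eqF//.
  by rewrite -normrM mulrC norm_sin_le.
- apply: aeW => s _.
  apply: (@cvg_comp _ _ _ (fun m => sin (u m * s) / u m) (fun x : R => x ^+ n)
    _ (nbhs (s : R))); last exact: (@exprn_continuous R n s).
  by apply: cvg_sinM_div => // m; rewrite gt_eqF.
- move=> m; have [] := @Rintegral_sinX_eq0 n (u m) 0.
    rewrite normr0 add0r gtr0_norm//.
    apply: (@le_lt_trans _ _ (n%:R * (delta / n.+1%:R))).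
      by rewrite ler_wpM2l// ler_piMr ?invf_le1 ?ler1n// divr_ge0// ltW.
    by rewrite mulrCA gtr_pMr// ltr_pdivrMr// mul1r ltr_nat.
  move=> + _; under eq_Rintegral do rewrite mul0r cos0 mulr1.
  move=> I0.
  transitivity (\int[mu]_s ((u m ^- n) * (sin (u m * s) ^+ n * f s))).
    by apply: eq_Rintegral => s _; rewrite exprMn exprVn; ring.
  rewrite RintegralZl ?I0 ?mulr0//.
  apply: eq_integrable (int_sinXcos n (u m) 0) => //= s _ /=.
  by rewrite mul0r cos0 mulr1.
Qed.

Lemma Rintegral_horner_eq0 (p : {poly R}) : 0 < delta ->
  \int[mu]_s (p.[s] * f s) = 0.
Proof.
move=> d0.
have int_mon n : mu.-integrable setT (EFin \o (fun s => s ^+ n * f s)).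
  apply: (@integrable_bddM _ _ _ mu (fun s => s ^+ n) f (M ^+ n)) => //.
  move=> s /fM' sM; rewrite normrX lerXn2r ?nnegrE//; exact: le_trans sM.
rewrite /Rintegral.
under eq_integral do rewrite horner_coef mulr_suml -sumEFin.
rewrite integral_sum//=; last first.
  move=> i; apply: eq_integrable (integrableZl _ p`_i (int_mon i)) => //= s _.
  by rewrite -mulrA.
rewrite big1// => i _.
under eq_integral do rewrite -mulrA EFinM.
rewrite integralZl//=; last exact: int_mon.
rewrite -[X in (_ * X)%E]fineK ?(integrable_fin_num _ (int_mon i))//.
by rewrite [fine _]Rintegral_moment_eq0// mule0.
Qed.

End low_frequencies.

(** * Polynomial approximation of the indicator of an interval *)

Section polynomial_steps.
Context {R : realType}.
Implicit Types x y : R.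

Lemma bernoulli_le y n : -1 <= y -> 1 + n%:R * y <= (1 + y) ^+ n.
Proof.
move=> y1; elim: n => [|n IH]; first by rewrite mul0r addr0 expr0.
have y0 : 0 <= 1 + y by lra.
rewrite exprSr; apply: le_trans (ler_wpM2r y0 IH).
rewrite -natr1; have : 0 <= n%:R * y ^+ 2 by rewrite mulr_ge0 ?sqr_ge0.
by nra.
Qed.

(** Bernoulli's inequality bounds the second factor by [(1 + y) ^+ n], and
    [(1 - y) * (1 + y) <= 1]. *)
Lemma bernoulli_ge y n : 0 <= y <= 1 -> (1 - y) ^+ n * (1 + n%:R * y) <= 1.
Proof.
move=> /andP[y0 y1].
apply: (@le_trans _ _ ((1 - y) ^+ n * (1 + y) ^+ n)).
  by rewrite ler_wpM2l ?exprn_ge0 ?subr_ge0// bernoulli_le//; lra.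
by rewrite -exprMn exprn_ile1//; nra.
Qed.

(* Polynomials in [x] converging on [`|x| <= m] to the indicator of [`|x| < 1]: with
   [y] the inner power and [N] the exponent, [N * y = x ^+ (2 * n)], so the
   Bernoulli bounds compare [(1 - y) ^+ N] with powers of [x]. *)
Definition step_approx (m n : nat) x : R :=
  (1 - (x / m%:R) ^+ (2 * n)) ^+ (m ^ (2 * n)).

Lemma step_approx_ge0_le1 m n x : (0 < m)%N -> `|x| <= m%:R -> 0 <= step_approx m n x <= 1.
Proof.
move=> m0 xm.
have /andP[y0 y1] : 0 <= (x / m%:R) ^+ (2 * n) <= 1.
  rewrite exprM exprn_ge0 ?sqr_ge0//= exprn_ile1 ?sqr_ge0//.
  rewrite -real_normK ?num_real// exprn_ile1// normrM normfV normr_nat.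
  by rewrite ler_pdivrMr ?mul1r ?ltr0n.
by rewrite /step_approx exprn_ge0 ?exprn_ile1//; lra.
Qed.

(** For [|x| < 1] the value lies between [1 - (x ^+ 2) ^+ n] and 1; for [|x| > 1] it lies between 0
    and [(x ^- 2) ^+ n]. At [|x| = 1] the limit is exp(-1) once [m > 1], hence the exclusion. *)
Lemma cvg_step_approx m x : (0 < m)%N -> `|x| <= m%:R -> `|x| != 1 ->
  step_approx m n x @[n --> \oo] --> ((`|x| < 1)%R%:R : R).
Proof.
move=> m0 xm x1.
have m0' : 0 < m%:R :> R by rewrite ltr0n.
have NyE n : (m ^ (2 * n))%:R * (x / m%:R) ^+ (2 * n) = (x ^+ 2) ^+ n.
  rewrite natrX -exprMn mulrCA divff ?mulr1 ?exprM//.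
  by rewrite gt_eqF.
have y01 n : 0 <= (x / m%:R) ^+ (2 * n) <= 1.
  rewrite exprM exprn_ge0 ?sqr_ge0//= exprn_ile1 ?sqr_ge0//.
  rewrite -real_normK ?num_real// exprn_ile1// normrM normfV normr_nat.
  by rewrite ler_pdivrMr ?mul1r.
move: x1; rewrite neq_lt => /orP[x1|x1]; rewrite ?x1.
  apply: (@squeeze_cvgr _ _ _ _ (fun n => 1 - (x ^+ 2) ^+ n) (cst 1)).
  - apply: nearW => n; have /andP[_ ->] := step_approx_ge0_le1 n m0 xm.
    rewrite andbT -NyE -mulrN; apply: bernoulli_le.
    by have /andP[] := y01 n; lra.
  - rewrite -[X in _ --> X]subr0; apply: cvgB; first exact: cvg_cst.
    by apply: cvg_expr; rewrite normrX exprn_ilt1.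
  - exact: cvg_cst.
rewrite ltNge (ltW x1) /=.
apply: (@squeeze_cvgr _ _ _ _ (cst 0) (fun n => (x ^- 2) ^+ n)).
- apply: nearW => n; have /andP[-> _] := step_approx_ge0_le1 n m0 xm => /=.
  have x0 : 0 < (x ^+ 2) ^+ n.
    by rewrite exprn_gt0// -real_normK ?num_real// exprn_gt0// (lt_trans _ x1).
  rewrite exprVn -[leRHS]mul1r ler_pdivlMr//.
  apply: le_trans (bernoulli_ge (m ^ (2 * n)) (y01 n)).
  rewrite NyE ler_wpM2l ?lerDr//.
  by have /andP[] := step_approx_ge0_le1 n m0 xm.
- exact: cvg_cst.
- apply: cvg_expr; rewrite normfV normrX invf_lt1 ?exprn_gt0 ?(lt_trans _ x1)//.
  by rewrite exprn_egt1.
Qed.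

End polynomial_steps.

(** * From vanishing moments to vanishing almost everywhere *)

Section ae_vanishing.
Context {R : realType}.
Notation mu := (@lebesgue_measure R).

(** At a Lebesgue point [x] the averages of [|f y - f x|] over small balls tend to 0. As [f]
    integrates to 0 over each ball, these averages are at least [|f x|]. *)
Lemma Rintegral_ball_ae_eq0 (f : R -> R) : mu.-integrable setT (EFin \o f) ->
  (forall c r, 0 < r -> \int[mu]_(s in ball c r) f s = 0) ->
  {ae mu, forall s, f s = 0}.
Proof.
move=> fi I0.
have /lebesgue_differentiation : locally_integrable setT f.
  by apply: open_integrable_locally => //; exact: openT.
apply: filterS; first exact: (ae_filter_ringOfSetsType mu).
move=> x Lx.
suff : (`|(f x)%:E| <= 0)%E by rewrite lee_fin normr_le0 => /eqP.
apply: (cvge_ge _ Lx).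
near=> r; have r0 : 0 < r by near: r; exact: nbhs_right_gt.
have mB : measurable (ball x r : set (measurableTypeR R)) by exact: measurable_ball.
have muB : mu (ball x r) = (r *+ 2)%:E by rewrite lebesgue_measure_ball// ltW.
have fB : mu.-integrable (ball x r) (EFin \o f) by exact: integrableS fi.
have cB : mu.-integrable (ball x r) (EFin \o cst (f x)).
  apply: measurable_bounded_integrable => //.
    by change (mu (ball x r) < +oo)%E; rewrite muB ltry.
  by exists `|f x|; split => // y /ltW fy z _.
have dB := integrableB mB fB cB.
have fB0 : (\int[mu]_(s in ball x r) (EFin \o f) s = 0)%E.
  by rewrite -[LHS]fineK ?integrable_fin_num// [fine _]I0.
have cB0 : (\int[mu]_(s in ball x r) (EFin \o cst (f x)) s = (f x * (r *+ 2))%:E)%E.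
  by rewrite EFinM -muB; exact: (integral_cst mu mB (f x)%:E).
have : ((`|f x| * (r *+ 2))%:E
    <= \int[mu]_(y in ball x r) `|(center (f x) (f y))%:E|)%E.
  apply: le_trans (le_abse_integral mu mB (measurable_int _ dB)).
  rewrite integralB// fB0 cB0 sub0e abseN abse_EFin.
  by rewrite normrM (ger0_norm (_ : 0 <= r *+ 2))// mulrn_wge0// ltW.
have r2 : 0 < r *+ 2 by rewrite mulrn_wgt0.
rewrite /davg /iavg muB inver gt_eqF// lee_pdivlMl// muleC.
Unshelve. all: by end_near. Qed.

(** The integral of [f] over a ball is a limit of integrals of [f] against the polynomials
    [step_approx], which all vanish because the moments do. *)
Lemma low_frequencies_ae_eq0 (f : R -> R) (delta M : R) : 0 < delta ->
  mu.-integrable setT (EFin \o f) -> (forall s, M < `|s| -> f s = 0) ->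
  (forall h, `|h| < delta -> \int[mu]_s (cos (h * s) * f s) = 0) ->
  (forall h, `|h| < delta -> \int[mu]_s (sin (h * s) * f s) = 0) ->
  {ae mu, forall s, f s = 0}.
Proof.
move=> d0 fi fM hcos hsin; apply: Rintegral_ball_ae_eq0 => // c r r0.
(* The step polynomials are controlled only on [|x| <= m%:R], so [m] is taken large enough for the
   rescaled support of [f] to fit there. *)
have [m [m0 sm]] : exists m : nat,
    (0 < m)%N /\ forall s, f s != 0 -> `|(s - c) / r| <= m%:R.
  exists (Num.trunc ((`|M| + `|c|) / r)).+1; split => // s fs.
  have sM : `|s| <= M by rewrite leNgt; apply: contraNN fs => /fM ->.
  rewrite normrM normfV (gtr0_norm r0).
  apply: (@le_trans _ _ ((`|M| + `|c|) / r)); last exact/ltW/truncnS_gt.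
  rewrite ler_wpM2r ?invr_ge0 ?(ltW r0)// (le_trans (ler_normB _ _))// lerD2r.
  exact: le_trans sM (ler_norm _).
rewrite Rintegral_mkcond.
transitivity (\int[mu]_s (\1_(ball c r) s * f s)).
  apply: eq_Rintegral => s _; rewrite patchE indicE.
  by case: ifPn; rewrite ?mul1r ?mul0r.
apply: (@dominated_Rintegral_eq0 _ _ _ mu
  (fun n s => step_approx m n ((s - c) / r)) _ _ 1) => //.
- move=> n; rewrite /step_approx.
  apply: measurable_funX; apply: measurable_funB => //.
  apply: measurable_funX; apply: measurable_funM => //.
  by apply: measurable_funM => //; exact: measurable_funB.
- by apply: measurable_indic; exact: measurable_ball.
- move=> n s /sm xm; have /andP[h0 h1] := step_approx_ge0_le1 n m0 xm.
  by rewrite ger0_norm.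
- have : {ae mu, forall s, s != c + r /\ s != c - r}.
    exists [set c + r; c - r]; split.
    + by apply: measurableU.
    + apply: countable_lebesgue_measure0; apply: finite_set_countable.
      exact: finite_set2.
    + move=> s /= /not_andP[|] /negP; rewrite negbK => /eqP ->; [by left|by right].
  apply: filterS; first exact: (ae_filter_ringOfSetsType mu).
  move=> s [s1 s2] /sm xm.
  rewrite indicE (_ : (s \in (ball c r : set R)) = (`|(s - c) / r| < 1)).
    apply: cvg_step_approx => //; apply/negP => /eqP.
    rewrite normrM normfV (gtr0_norm r0) => /(congr1 (fun y => y * r)).
    rewrite divfK ?gt_eqF// mul1r => sr.
    have [sc|sc] := leP 0 (s - c).
      by move: sr s1; rewrite ger0_norm// => <-; rewrite addrC subrK eqxx.
    by move: sr s2; rewrite ltr0_norm// => <-; rewrite opprK addrC subrK eqxx.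
  apply/idP/idP; rewrite inE /ball/= distrC normrM normfV (gtr0_norm r0);
    by rewrite ltr_pdivrMr// mul1r.
- move=> n.
  pose p : {poly R} :=
    (1 - ((m%:R * r)^-1 *: ('X - c%:P)) ^+ (2 * n)) ^+ (m ^ (2 * n)).
  rewrite -(Rintegral_horner_eq0 fi hcos hsin fM p d0).
  apply: eq_Rintegral => s _; congr (_ * _).
  by rewrite /p /step_approx !hornerE invfM; congr ((1 - _ ^+ _) ^+ _); ring.
Qed.

End ae_vanishing.

(** * Affine change of variables on the line *)

Section affine_substitution.
Context {R : realType}.
Notation mu := (@lebesgue_measure R).
Variables (a b : R).
Hypothesis a0 : a != 0.

Let phi (x : measurableTypeR R) : measurableTypeR R := a * x + b.

Let mphi : measurable_fun setT phi.
Proof. by apply: measurable_funD => //; exact: measurable_funM. Qed.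

Let phi_mfun : {mfun measurableTypeR R >-> measurableTypeR R} :=
  MeasurableFun.Pack (MeasurableFun.Class (isMeasurableFun.Build _ _ _ _ phi mphi)).

Let phi_preimage_itv (u v : R) : u < v ->
  mu (phi @^-1` `]u, v]) = ((v - u) / `|a|)%:E.
Proof.
move=> uv; move: a0; rewrite neq_lt => /orP[an|ap].
- rewrite (_ : _ @^-1` _ = `[(v - b) / a, (u - b) / a[%classic).
    have h : (v - b) / a < (u - b) / a by rewrite ltr_nM2r ?invr_lt0// ltrD2r.
    rewrite lebesgue_measure_itv/= lte_fin h -EFinB ltr0_norm// invrN.
    by congr EFin; ring.
  apply/seteqP; split => x /=; rewrite !in_itv/= /phi ler_ndivrMr// ltr_ndivlMr//;
    rewrite !(mulrC x) lerBrDr ltrBlDr; by case/andP => -> ->.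
- rewrite (_ : _ @^-1` _ = `](u - b) / a, (v - b) / a]%classic).
    have h : (u - b) / a < (v - b) / a by rewrite ltr_pM2r ?invr_gt0// ltrD2r.
    rewrite lebesgue_measure_itv/= lte_fin h -EFinB gtr0_norm//.
    by congr EFin; ring.
  apply/seteqP; split => x /=; rewrite !in_itv/= /phi ltr_pdivrMr// ler_pdivlMr//;
    rewrite !(mulrC x) lerBrDr ltrBlDr; by case/andP => -> ->.
Qed.

(** Lebesgue measure equals [|a|] times its own pushforward under [phi]: the two agree on half-open
    intervals, and this determines the measure. *)
Lemma ge0_integral_affine (f : R -> \bar R) : measurable_fun setT f ->
  (forall x, 0 <= f x)%E ->
  (\int[mu]_x f (a * x + b)%R = `|a|^-1%:E * \int[mu]_x f x)%E.
Proof.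
move=> mf f0.
pose k : {nonneg R} := NngNum (normr_ge0 a).
have muE A : measurable A -> mu A = mscale k (pushforward mu phi_mfun) A.
  apply: lebesgue_measure_unique => _ [[u v] _ <-] /=.
  rewrite /mscale/= /pushforward.
  have [vu|uv] := leP v u.
    by rewrite set_itv_ge ?bnd_simp -?leNgt// preimage_set0 !measure0 mule0.
  rewrite lebesgue_measure_itv/= lte_fin uv phi_preimage_itv// -EFinM -EFinB.
  by rewrite mulrC divfK// normr_eq0.
rewrite [in RHS](eq_measure_integral (mscale k (pushforward mu phi_mfun))); last first.
  by move=> A mA _; exact: muE.
rewrite ge0_integral_mscale//= ge0_integral_pushforward//= preimage_setT.
by rewrite muleA -EFinM mulVf ?normr_eq0// mul1e.
Qed.

End affine_substitution.

(** * Invariance of plane Lebesgue measure under the line coordinates *)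

Section rotation.
Context {R : realType}.
Notation mu := (@lebesgue_measure R).

(* The parametrization of the lines [Pi_line x alpha] used in [f_proj]. *)
Definition line_coord (x p : R * R) : R * R :=
  (- p.1 * x.1 - p.2 * x.2, - p.1 * x.2 + p.2 * x.1).

Lemma dot2_line_coord (x p : R * R) : unit_circle x -> dot2 x (line_coord x p) = - p.1.
Proof.
move=> x1; transitivity (- p.1 * dot2 x x); last by rewrite x1 mulr1.
by rewrite /dot2 /line_coord/=; ring.
Qed.

Lemma measurable_line_coord (x : R * R) : measurable_fun setT (line_coord x).
Proof.
apply: measurable_fun_pair.
- apply: measurable_funB; apply: measurable_funM => //.
  by apply: measurableT_comp => //; exact: measurable_fst.
- apply: measurable_funD; apply: measurable_funM => //.
  by apply: measurableT_comp => //; exact: measurable_fst.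
Qed.

Section tonelli.
Variable g : R * R -> \bar R.
Hypothesis mg : measurable_fun setT g.
Hypothesis g0 : (forall y, 0 <= g y)%E.

Lemma tonelli1 : (\int[@leb2 R]_y g y = \int[mu]_u \int[mu]_v g (u, v))%E.
Proof. exact: (@fubini_tonelli1 _ _ _ _ R mu mu g). Qed.

Lemma tonelli : (\int[mu]_u \int[mu]_v g (u, v) = \int[mu]_v \int[mu]_u g (u, v))%E.
Proof. exact: (@fubini_tonelli _ _ _ _ R mu mu g). Qed.

Lemma measurable_tonelli_F : measurable_fun setT (fun u : R => \int[mu]_v g (u, v))%E.
Proof. exact: (@measurable_fun_fubini_tonelli_F _ _ _ _ R mu g). Qed.

Lemma measurable_tonelli_G : measurable_fun setT (fun v : R => \int[mu]_u g (u, v))%E.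
Proof. exact: (@measurable_fun_fubini_tonelli_G _ _ _ _ R mu g). Qed.

End tonelli.

(** The orthogonal change of coordinates is carried out one variable at a time, by Tonelli and
    affine substitutions whose Jacobian factors cancel. *)
Lemma ge0_integral_line_coord (x : R * R) (f : R * R -> \bar R) :
  unit_circle x -> measurable_fun setT f -> (forall y, 0 <= f y)%E ->
  (\int[@leb2 R]_p f (line_coord x p) = \int[@leb2 R]_y f y)%E.
Proof.
move=> x1 mf f0; rewrite /leb2.
have mfT : measurable_fun setT (f \o line_coord x).
  by apply: measurableT_comp => //; exact: measurable_line_coord.
have msec1 (u : R) : measurable_fun setT (fun v : R => f (u, v)) by exact: measurableT_comp.
have msec2 (v : R) : measurable_fun setT (fun u : R => f (u, v)) by exact: measurableT_comp.
case: x x1 mfT => c s; rewrite /unit_circle /dot2 /= => x1 mfT.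
rewrite (tonelli1 mfT)//= /line_coord/=.
(* If [s = 0] the coordinates already separate, with [c] equal to 1 or -1; the general argument
   divides by [s]. *)
have [s0|s0] := eqVneq s 0.
  have c1 : `|c| = 1.
    by apply/eqP; rewrite -sqr_norm_eq1 -x1 s0; apply/eqP; ring.
  have c0 : c != 0 by rewrite -normr_eq0 c1 oner_eq0.
  transitivity (\int[mu]_p \int[mu]_v f ((- c * p + 0)%R, v))%E.
    apply: eq_integral => p _.
    have := ge0_integral_affine 0 c0 (msec1 (- c * p + 0)) (fun v => f0 _).
    rewrite c1 invr1 mul1e => <-.
    by apply: eq_integral => t _; rewrite s0; congr (f (_, _)); ring.
  rewrite (ge0_integral_affine (a := - c) 0 _ (f := fun u => \int[mu]_v f (u, v))%E) ?oppr_eq0//.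
  - by rewrite normrN c1 invr1 mul1e -tonelli1.
  - exact: measurable_tonelli_F.
  - by move=> u; exact: integral_ge0.
(* The new variable is the first coordinate [u = - p * c - s * t]. Eliminating [t] and using
   [c * c + s * s = 1], the second coordinate becomes [- p / s - c * u / s]. *)
pose g (p : R * R) := f (p.2, - s^-1 * p.1 + - (c * p.2) / s)%R.
have mg : measurable_fun setT g.
  apply: (measurableT_comp mf); apply: measurable_fun_pair => //.
  apply: measurable_funD; apply: measurable_funM => //.
  by apply: measurableT_comp => //; exact: measurable_funM.
have mgsec (p : R) : measurable_fun setT (fun u : R => g (p, u)) by exact: measurableT_comp.
have cc : c * c = 1 - s * s by rewrite -x1; ring.
transitivity (\int[mu]_p (`|- s|^-1%:E * \int[mu]_u g (p, u)))%E.
  apply: eq_integral => p _.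
  have sN0 : - s != 0 by rewrite oppr_eq0.
  have <- := ge0_integral_affine (- p * c) sN0 (mgsec p) (fun u => f0 _).
  apply: eq_integral => t _; rewrite /g/=; congr (f (_, _)); first by ring.
  transitivity ((- p + c * s * t + p * (c * c)) / s); last by field.
  by apply: (canRL (mulfK s0)); rewrite cc; ring.
rewrite ge0_integralZl//; last 2 first.
- exact: (measurable_tonelli_F mg (fun p => f0 _)).
- by move=> p _; apply: integral_ge0 => u _; exact: f0.
rewrite (tonelli mg); last by move=> p; exact: f0.
rewrite [RHS](tonelli1 mf f0).
rewrite -ge0_integralZl//; last 2 first.
- exact: (measurable_tonelli_G mg (fun p => f0 _)).
- by move=> u _; apply: integral_ge0 => p _; exact: f0.
(* The remaining substitution in [p] has slope [- s^-1]; its factor [|s|] cancels the [|s|^-1]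
   produced by the first one. *)
apply: eq_integral => u _; rewrite /g/= /fubini_F.
rewrite (ge0_integral_affine (a := - s^-1) _ _ (f := fun v => f (u, v))) ?oppr_eq0 ?invr_eq0//.
by rewrite muleA -EFinM !normrN normfV invrK mulVf ?mul1e// normr_eq0.
Qed.

End rotation.

(** * Fubini along the lines orthogonal to a direction *)

Section line_integrals.
Context {R : realType}.
Notation mu := (@lebesgue_measure R).
Variable x : R * R.
Hypothesis x1 : unit_circle x.

Lemma integral_line_coord (f : R * R -> \bar R) : measurable_fun setT f ->
  (\int[@leb2 R]_p f (line_coord x p) = \int[@leb2 R]_y f y)%E.
Proof.
move=> mf; rewrite integralE [RHS]integralE.
have <- := ge0_integral_line_coord x1 (measurable_funepos mf) (fun y => funepos_ge0 f y).
have <- := ge0_integral_line_coord x1 (measurable_funeneg mf) (fun y => funeneg_ge0 f y).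
by congr (_ - _)%E; apply: eq_integral => p _; rewrite ?funeposE ?funenegE.
Qed.

Lemma integrable_line_coord (f : R * R -> \bar R) :
  (@leb2 R).-integrable setT f -> (@leb2 R).-integrable setT (f \o line_coord x).
Proof.
move=> /integrableP[mf fy]; apply/integrableP; split.
  by apply: (measurableT_comp mf); exact: measurable_line_coord.
have mabs : measurable_fun setT (abse \o f) by exact: measurableT_comp.
by have := ge0_integral_line_coord x1 mabs (fun y => abse_ge0 _) => /= ->.
Qed.

Definition line_integral (g : R * R -> R) (alpha : R) : R :=
  \int[mu]_t g (line_coord x (alpha, t)).

Variable g : R * R -> R.
Hypothesis gi : (@leb2 R).-integrable setT (EFin \o g).

Let giT := integrable_line_coord gi.

Let ae_int : {ae mu, forall alpha, mu.-integrable setT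
  (EFin \o (fun t => g (line_coord x (alpha, t))))}.
Proof. exact: (ae_integrable1 giT). Qed.

(** Fubini gives integrability of the extended-real inner integral, and taking [fine] does not
    increase absolute values. *)
Lemma integrable_line_integral :
  mu.-integrable setT (EFin \o line_integral g).
Proof.
have mF := measurable_fubini_F giT.
apply: le_integrable (integrable_fubini_F giT) => //.
  by apply/measurable_EFinP; exact: (measurableT_comp (fine_measurable _)).
have le_fine (z : \bar R) : (`|(fine z)%:E| <= `|z|)%E.
  by case: z => //=; rewrite normr0 leey.
by move=> alpha _; exact: le_fine.
Qed.

(** On the line with parameter [alpha] the product [dot2 x y] is constantly [- alpha], so [h] leaves
    the inner integral. *)
Lemma Rintegral_line_integral (h : R -> R) (C : R) : measurable_fun setT h ->
  (forall s, `|h s| <= C) ->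
  \int[@leb2 R]_y (h (dot2 x y) * g y)
  = \int[mu]_alpha (h (- alpha) * line_integral g alpha).
Proof.
move=> mh hC.
have mdot : measurable_fun setT (fun y : R * R => h (dot2 x y)).
  apply: (measurableT_comp mh); apply: measurable_funD; exact: measurable_funM.
have hgi : (@leb2 R).-integrable setT (EFin \o ((fun y => h (dot2 x y)) \* g)).
  by apply: (@integrable_bddM _ _ _ (@leb2 R) (fun y => h (dot2 x y)) g C).
have hgiT := integrable_line_coord hgi.
rewrite /Rintegral; congr fine.
rewrite -[LHS](integral_line_coord (measurable_int _ hgi)).
rewrite -[LHS](integral12_prod_meas1 hgiT).
(* The inner integrals are compared only at those [alpha] whose slice is integrable; at the others
   [fine] may lose an infinite value. *)
apply: ae_eq_integral => //.
- exact: measurable_fubini_F hgiT.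
- apply/measurable_EFinP; apply: measurable_funM.
    by apply: (measurableT_comp mh).
  by have /measurable_EFinP := measurable_int _ integrable_line_integral.
- move: ae_int; apply: filterS; first exact: (ae_filter_ringOfSetsType mu).
  move=> alpha ia _; rewrite /fubini_F/=.
  under eq_integral do rewrite dot2_line_coord//= EFinM.
  rewrite integralZl// EFinM /line_integral /Rintegral fineK//.
  exact: integrable_fin_num.
Qed.

End line_integrals.

(** * Phase retrieval from three source strengths *)

Section phase_retrieval.
Context {R : realType}.

(** After squaring, the square of [|t|] cancels and an equation affine in [t] remains. *)
Lemma normC_sqr_sub (w1 w2 t : R[i]) : `|w1 + t| = `|w2 + t| ->
  complex.Re w1 ^+ 2 + complex.Im w1 ^+ 2 - complex.Re w2 ^+ 2 - complex.Im w2 ^+ 2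
  + 2 * (complex.Re (w1 - w2) * complex.Re t + complex.Im (w1 - w2) * complex.Im t) = 0.
Proof.
case: w1 w2 t => [a b] [c d] [e f] /=; rewrite !normc_def => /(congr1 (@complex.Re R))/=.
move=> /(congr1 (fun z => z ^+ 2)); rewrite !sqr_sqrtr ?addr_ge0 ?sqr_ge0//.
by move=> /eqP; rewrite -subr_eq0 => /eqP <-; ring.
Qed.

(* If [w1 <> w2], the three points [- tau_j] lie on the perpendicular bisector of
   [w1] and [w2], hence are collinear. *)
Lemma phase_retrieval (tau1 tau2 tau3 w1 w2 : R[i]) :
  (forall a b : R,
    a%:C * (tau2 - tau1) + b%:C * (tau3 - tau1) = 0 -> a = 0 /\ b = 0) ->
  `|w1 + tau1| = `|w2 + tau1| -> `|w1 + tau2| = `|w2 + tau2| ->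
  `|w1 + tau3| = `|w2 + tau3| -> w1 = w2.
Proof.
move=> ind /normC_sqr_sub e1 /normC_sqr_sub e2 /normC_sqr_sub e3.
case: tau1 tau2 tau3 w1 w2 ind e1 e2 e3 => [a1 b1] [a2 b2] [a3 b3] [x1 y1] [x2 y2].
simpc => /= ind e1 e2 e3.
(* With a zero determinant, the imaginary parts of the two differences are coefficients of a
   vanishing combination, and so are the real parts. Independence makes all of them 0, so both
   differences vanish, which is absurd. *)
have det0 : (a2 - a1) * (b3 - b1) - (a3 - a1) * (b2 - b1) != 0.
  apply/eqP => det.
  have [] := ind (b3 - b1) (- (b2 - b1)).
    by simpc; congr (_ +i* _); [rewrite -[RHS]det|]; ring.
  move=> h3 h2.
  have [] := ind (a3 - a1) (- (a2 - a1)).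
    by simpc; congr (_ +i* _); [|rewrite -oppr0 -[in RHS]det]; ring.
  move=> h3' h2'.
  have [] := ind 1 0; last by move/eqP; rewrite oner_eq0.
  by simpc; congr (_ +i* _); lra.
(* Subtracting the equation for the first strength leaves a homogeneous linear system for [w1 - w2],
   solved by Cramer's rule. *)
have e21 : (x1 - x2) * (a2 - a1) + (y1 - y2) * (b2 - b1) = 0.
  by move: e1 e2; lra.
have e31 : (x1 - x2) * (a3 - a1) + (y1 - y2) * (b3 - b1) = 0.
  by move: e1 e3; lra.
have dx : x1 - x2 = 0.
  apply: (mulIf det0); rewrite mul0r.
  by transitivity (0 * (b3 - b1) - 0 * (b2 - b1)); [rewrite -{1}e21 -e31|]; ring.
have dy : y1 - y2 = 0.
  apply: (mulIf det0); rewrite mul0r.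
  by transitivity (0 * (a2 - a1) - 0 * (a3 - a1)); [rewrite -{1}e31 -e21|]; ring.
by congr (_ +i* _); apply/eqP; rewrite -subr_eq0 ?dx ?dy.
Qed.

End phase_retrieval.

(** * Uniqueness from a band of frequencies *)

Section band_limited_data.
Context {R : realType}.
Notation mu := (@lebesgue_measure R).

Lemma integrable_trigM (a : R) (f : R -> R) : mu.-integrable setT (EFin \o f) ->
  mu.-integrable setT (EFin \o (fun s => cos (a * s) * f s)) /\
  mu.-integrable setT (EFin \o (fun s => sin (a * s) * f s)).
Proof.
move=> fi; split.
  apply: (@integrable_bddM _ _ _ mu (fun s => cos (a * s)) f 1) => //.
    exact: measurable_cosM.
  by move=> s _; exact: cos_max.
apply: (@integrable_bddM _ _ _ mu (fun s => sin (a * s)) f 1) => //.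
  exact: measurable_sinM.
by move=> s _; exact: sin_max.
Qed.

(* Modulating by the middle frequency [k0] moves the band to a neighbourhood of
   the origin, and the frequencies [h] and [- h] decouple cosine and sine. *)
Lemma frequency_band_ae_eq0 (P Q : R -> R) (kmin kmax M : R) : kmin < kmax ->
  mu.-integrable setT (EFin \o P) -> mu.-integrable setT (EFin \o Q) ->
  (forall s, M < `|s| -> P s = 0) -> (forall s, M < `|s| -> Q s = 0) ->
  (forall k, kmin < k < kmax ->
    \int[mu]_s (cos (k * s) * P s - sin (k * s) * Q s) = 0 /\
    \int[mu]_s (cos (k * s) * Q s + sin (k * s) * P s) = 0) ->
  {ae mu, forall s, P s = 0 /\ Q s = 0}.
Proof.
move=> kk iP iQ PM QM I0.
pose k0 := (kmin + kmax) / 2; pose delta := (kmax - kmin) / 2.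
have d0 : 0 < delta by rewrite /delta; lra.
(* [A] and [B] are the real and imaginary parts of [P + i Q] multiplied by exp(i [k0] s). *)
pose A s := cos (k0 * s) * P s - sin (k0 * s) * Q s.
pose B s := cos (k0 * s) * Q s + sin (k0 * s) * P s.
have iA : mu.-integrable setT (EFin \o A).
  exact: (integrableB _ (integrable_trigM _ iP).1 (integrable_trigM _ iQ).2).
have iB : mu.-integrable setT (EFin \o B).
  exact: (integrableD _ (integrable_trigM _ iQ).1 (integrable_trigM _ iP).2).
have iAB h := (integrable_trigM h iA, integrable_trigM h iB).
have AB h : `|h| < delta ->
    \int[mu]_s (cos (h * s) * A s) = \int[mu]_s (sin (h * s) * B s) /\
    \int[mu]_s (cos (h * s) * B s) = - \int[mu]_s (sin (h * s) * A s).
  rewrite ltr_norml => /andP[h1 h2].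
  have kh : kmin < k0 + h < kmax by move: h1 h2; rewrite /k0 /delta; lra.
  have [I1 I2] := I0 _ kh.
  have [[cA sA] [cB sB]] := iAB h.
  split.
    apply/eqP; rewrite -subr_eq0 -RintegralB//; apply/eqP; rewrite -[RHS]I1.
    apply: eq_Rintegral => s _; rewrite mulrDl cosD sinD /A /B; ring.
  apply/eqP; rewrite -addr_eq0 -RintegralD//; apply/eqP; rewrite -[RHS]I2.
  apply: eq_Rintegral => s _; rewrite mulrDl cosD sinD /A /B; ring.
have even h f : \int[mu]_s (cos (- h * s) * f s) = \int[mu]_s (cos (h * s) * f s).
  by apply: eq_Rintegral => s _; rewrite mulNr cosN.
have odd_ h f : mu.-integrable setT (EFin \o f) ->
    \int[mu]_s (sin (- h * s) * f s) = - \int[mu]_s (sin (h * s) * f s).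
  move=> fi; rewrite -[RHS]mulN1r -RintegralZl//; last exact: (integrable_trigM h fi).2.
  by apply: eq_Rintegral => s _; rewrite mulNr sinN; ring.
have Z h : `|h| < delta ->
    [/\ \int[mu]_s (cos (h * s) * A s) = 0, \int[mu]_s (sin (h * s) * A s) = 0,
        \int[mu]_s (cos (h * s) * B s) = 0 & \int[mu]_s (sin (h * s) * B s) = 0].
  move=> hd; have [e1 e2] := AB h hd.
  have [] := AB (- h); first by rewrite normrN.
  by rewrite !even !odd_// => e3 e4; split; lra.
have A0 : {ae mu, forall s, A s = 0}.
  apply: (low_frequencies_ae_eq0 (M := M) d0 iA) => [s sM|h /Z[]|h /Z[]] //.
  by rewrite /A PM// QM// !mulr0 subr0.
have B0 : {ae mu, forall s, B s = 0}.
  apply: (low_frequencies_ae_eq0 (M := M) d0 iB) => [s sM|h /Z[]|h /Z[]] //.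
  by rewrite /B PM// QM// !mulr0 addr0.
move: A0 B0; apply: filterS2; first exact: (ae_filter_ringOfSetsType mu).
(* Multiplying by exp(-i [k0] s) recovers [P] and [Q] from [A] and [B]. *)
move=> s As Bs; have cs := cos2Dsin2 (k0 * s); split.
  transitivity (cos (k0 * s) * A s + sin (k0 * s) * B s); last by rewrite As Bs !mulr0 addr0.
  by rewrite /A /B -[LHS]mul1r -cs; ring.
transitivity (cos (k0 * s) * B s - sin (k0 * s) * A s); last by rewrite As Bs !mulr0 subr0.
by rewrite /A /B -[LHS]mul1r -cs; ring.
Qed.

End band_limited_data.

(** * Integrability of the sources, and the far field as a Fourier transform *)

Section compactly_supported_sources.
Context {R : realType}.
Notation mu := (@lebesgue_measure R).

(** Square integrability gives integrability on a set of finite measure: [|u| <= u ^+ 2 + 1] on the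
    box, and [u] vanishes off it. *)
Lemma integrable_sqr_box (u v : R * R -> R) (M : R) :
  measurable_fun setT u -> measurable_fun setT v ->
  (\int[@leb2 R]_y (v y)%:E < +oo)%E ->
  (forall y, u y ^+ 2 <= v y) ->
  (forall y, u y != 0 -> `|y.1| <= M /\ `|y.2| <= M) ->
  (@leb2 R).-integrable setT (EFin \o u).
Proof.
move=> mu_u mu_v vfin uv uM.
pose box : set (R * R) := `[- M, M] `*` `[- M, M].
have mbox : measurable box by exact: measurableX.
have boxfin : (@leb2 R box < +oo)%E.
  rewrite /leb2 product_measure1E//= !lebesgue_measure_itv/=.
  by case: ifPn => _; rewrite ?mule0// -EFinB -EFinM ltry.
have ibox : (@leb2 R).-integrable setT (EFin \o (\1_box : R * R -> R)).
  apply/integrableP; split; first exact/measurable_EFinP.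
  under eq_integral do rewrite /= ger0_norm//.
  by rewrite integral_indic// setIT.
have iv : (@leb2 R).-integrable setT (EFin \o v).
  apply/integrableP; split; first exact/measurable_EFinP.
  under eq_integral do rewrite /= ger0_norm ?(le_trans (sqr_ge0 _) (uv _))//.
  exact: vfin.
apply: le_integrable (integrableD _ iv ibox) => //; first exact/measurable_EFinP.
move=> y _ /=; rewrite lee_fin indicE.
have v0 : 0 <= v y := le_trans (sqr_ge0 _) (uv y).
rewrite [leRHS]ger0_norm ?addr_ge0//.
have [->|uy] := eqVneq (u y) 0; first by rewrite normr0 addr_ge0.
have -> : y \in box.
  by rewrite inE /box /=; have [] := uM _ uy; rewrite !in_itv/= !ler_norml.
apply: (@le_trans _ _ (u y ^+ 2 + 1)); last by rewrite lerD2r.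
by rewrite -real_normK ?num_real//; have := normr_ge0 (u y); nra.
Qed.

Lemma cL2_integrable (g : R * R -> R[i]) (M : R) : cL2 g ->
  (forall y, g y != 0 -> `|y.1| <= M /\ `|y.2| <= M) ->
  (@leb2 R).-integrable setT (EFin \o (fun y => complex.Re (g y))) /\
  (@leb2 R).-integrable setT (EFin \o (fun y => complex.Im (g y))).
Proof.
move=> [mr [mi fin]] gM.
have mv : measurable_fun setT (fun y => complex.Re (g y) ^+ 2 + complex.Im (g y) ^+ 2).
  by apply: measurable_funD; exact: measurable_funX.
split.
- apply: (integrable_sqr_box mr mv fin) => [y|y yr].
    by rewrite lerDl sqr_ge0.
  by apply: gM; apply: contraNneq yr => ->.
- apply: (integrable_sqr_box mi mv fin) => [y|y yi].
    by rewrite lerDr sqr_ge0.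
  by apply: gM; apply: contraNneq yi => ->.
Qed.

Definition Re_dotc (x : R * R) (F : R * R -> R[i] * R[i]) y := complex.Re (dotc x (F y)).
Definition Im_dotc (x : R * R) (F : R * R -> R[i] * R[i]) y := complex.Im (dotc x (F y)).

Lemma Re_dotcE x F y :
  Re_dotc x F y = x.1 * complex.Re (F y).1 + x.2 * complex.Re (F y).2.
Proof. by rewrite /Re_dotc /dotc; case: (F y) => [[a b] [c d]]; simpc. Qed.

Lemma Im_dotcE x F y :
  Im_dotc x F y = x.1 * complex.Im (F y).1 + x.2 * complex.Im (F y).2.
Proof. by rewrite /Im_dotc /dotc; case: (F y) => [[a b] [c d]]; simpc. Qed.

Lemma vL2_integrable_dotc (x : R * R) (F : R * R -> R[i] * R[i]) (M : R) : vL2 F ->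
  (forall y, F y != (0, 0) -> `|y.1| <= M /\ `|y.2| <= M) ->
  (@leb2 R).-integrable setT (EFin \o Re_dotc x F) /\
  (@leb2 R).-integrable setT (EFin \o Im_dotc x F).
Proof.
move=> [F1 F2] FM.
have [] := cL2_integrable (M := M) F1.
  by move=> y y0; apply: FM; apply: contraNneq y0 => ->.
move=> r1 i1; have [] := cL2_integrable (M := M) F2.
  by move=> y y0; apply: FM; apply: contraNneq y0 => ->.
move=> r2 i2; split.
- apply: eq_integrable (integrableD _ (integrableZl _ x.1 r1) (integrableZl _ x.2 r2)) => //.
  by move=> y _ /=; rewrite Re_dotcE.
- apply: eq_integrable (integrableD _ (integrableZl _ x.1 i1) (integrableZl _ x.2 i2)) => //.
  by move=> y _ /=; rewrite Im_dotcE.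
Qed.

Lemma realCDi (a b : R) : a%:C + 'i * b%:C = a +i* b.
Proof. by simpc. Qed.

Lemma f_proj_line_integral (F : R * R -> R[i] * R[i]) (x : R * R) (alpha : R) :
  f_proj F x alpha =
  line_integral x (Re_dotc x F) alpha +i* line_integral x (Im_dotc x F) alpha.
Proof. by rewrite /f_proj /cint realCDi. Qed.

(** This is the projection-slice identity. Since [dot2 x y = - s] on the line with parameter [s],
    the kernel exp(-i k x.y) becomes exp(i k s). *)
Lemma farfield_p_line_integral (lam mu_ omega : R) (F : R * R -> R[i] * R[i])
    (x : R * R) (k := kp lam mu_ omega)
    (P := line_integral x (Re_dotc x F)) (Q := line_integral x (Im_dotc x F)) :
  unit_circle x ->
  (@leb2 R).-integrable setT (EFin \o Re_dotc x F) ->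
  (@leb2 R).-integrable setT (EFin \o Im_dotc x F) ->
  farfield_p lam mu_ F x omega =
  (\int[mu]_s (cos (k * s) * P s - sin (k * s) * Q s)) +i*
  (\int[mu]_s (cos (k * s) * Q s + sin (k * s) * P s)).
Proof.
move=> x1 ip iq.
have iP := integrable_line_integral x1 ip; have iQ := integrable_line_integral x1 iq.
have bdd (h : R -> R) (C : R) g : measurable_fun setT h -> (forall s, `|h s| <= C) ->
    (@leb2 R).-integrable setT (EFin \o g) ->
    (@leb2 R).-integrable setT (EFin \o (fun y => h (dot2 x y) * g y)).
  move=> mh hC ig.
  apply: (@integrable_bddM _ _ _ (@leb2 R) (fun y => h (dot2 x y)) g C) => //.
  apply: (measurableT_comp mh); apply: measurable_funD; exact: measurable_funM.
have mc := measurable_cosM k; have ms := measurable_sinM k.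
have hc s : `|cos (k * s)| <= 1 by exact: cos_max.
have hs s : `|sin (k * s)| <= 1 by exact: sin_max.
have cE g : (@leb2 R).-integrable setT (EFin \o g) ->
    \int[@leb2 R]_y (cos (k * dot2 x y) * g y)
    = \int[mu]_s (cos (k * s) * line_integral x g s).
  move=> ig; rewrite (Rintegral_line_integral x1 ig mc hc).
  by apply: eq_Rintegral => s _; rewrite mulrN cosN.
have sE g : (@leb2 R).-integrable setT (EFin \o g) ->
    \int[@leb2 R]_y (sin (k * dot2 x y) * g y)
    = - \int[mu]_s (sin (k * s) * line_integral x g s).
  move=> ig; rewrite (Rintegral_line_integral x1 ig ms hs).
  rewrite -[RHS]mulN1r -RintegralZl//.
    by apply: eq_Rintegral => s _; rewrite mulrN sinN; ring.
  exact: (integrable_trigM k (integrable_line_integral x1 ig)).2.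
rewrite /farfield_p /cint -/k realCDi; congr (_ +i* _).
- transitivity (\int[@leb2 R]_y (cos (k * dot2 x y) * Re_dotc x F y
      + sin (k * dot2 x y) * Im_dotc x F y)).
    apply: eq_Rintegral => y _; rewrite /Re_dotc /Im_dotc /cexpi cosN sinN.
    by case: (dotc x (F y)) => a b; simpc.
  rewrite RintegralD//; [|exact: bdd mc hc ip|exact: bdd ms hs iq].
  rewrite cE// sE// -RintegralB//; [exact: (integrable_trigM k iP).1|].
  exact: (integrable_trigM k iQ).2.
- transitivity (\int[@leb2 R]_y (cos (k * dot2 x y) * Im_dotc x F y
      - sin (k * dot2 x y) * Re_dotc x F y)).
    apply: eq_Rintegral => y _; rewrite /Re_dotc /Im_dotc /cexpi cosN sinN.
    by case: (dotc x (F y)) => a b; simpc.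
  rewrite RintegralB//; [|exact: bdd mc hc iq|exact: bdd ms hs ip].
  rewrite cE// sE// opprK -RintegralD//; [exact: (integrable_trigM k iQ).1|].
  exact: (integrable_trigM k iP).2.
Qed.

End compactly_supported_sources.

(** * Geometry of strips, and vanishing of line integrals outside them *)

Section strips.
Context {R : realType}.
Notation mu := (@lebesgue_measure R).
Implicit Types (Om : set (R * R)) (x y w : R * R).

Lemma dot2C x y : dot2 x y = dot2 y x.
Proof. by rewrite /dot2 mulrC (mulrC x.2). Qed.

Lemma continuous_dot2 x : continuous (fun y => dot2 y x).
Proof.
move=> y; apply: cvgD; apply: cvgMr_tmp; [exact: cvg_fst|exact: cvg_snd].
Qed.

Lemma closure_le Om (h : R * R -> R) (c : R) : continuous h ->
  (forall w, Om w -> h w <= c) -> forall w, closure Om w -> h w <= c.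
Proof.
move=> hc hO w.
have cl : closed [set y | h y <= c].
  apply: (@closed_comp _ _ h [set r | r <= c]); last exact: closed_le.
  by move=> y _; exact: hc.
move/(closure_subset hO); rewrite -((closure_id _).1 cl); exact.
Qed.

Lemma closure_bounded Om (M : R) : (forall w, Om w -> `|w.1| <= M /\ `|w.2| <= M) ->
  forall w, closure Om w -> `|w.1| <= M /\ `|w.2| <= M.
Proof.
move=> OM w Ow; split.
- apply: (closure_le (h := fun y => `|y.1|)) Ow => [y|v /OM[]//].
  by apply: cvg_norm; exact: cvg_fst.
- apply: (closure_le (h := fun y => `|y.2|)) Ow => [y|v /OM[]//].
  by apply: cvg_norm; exact: cvg_snd.
Qed.

Definition strip_min Om x := inf [set dot2 w x | w in Om].
Definition strip_max Om x := sup [set dot2 w x | w in Om].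

Lemma bounded_domain_dot2 Om x w : bounded_domain Om -> Om w ->
  strip_min Om x <= dot2 w x <= strip_max Om x.
Proof.
move=> [_ [_ [_ [M OM]]]] Ow.
pose C := M * `|x.1| + M * `|x.2|.
have bd v : Om v -> `|dot2 v x| <= C.
  move=> /OM[v1 v2]; rewrite (le_trans (ler_normD _ _))// !normrM.
  by rewrite lerD// ler_wpM2r.
apply/andP; split.
  apply: ge_inf; last by exists w.
  by exists (- C) => _ [v /bd + <-]; rewrite ler_norml => /andP[].
apply: ub_le_sup; last by exists w.
by exists C => _ [v /bd + <-]; rewrite ler_norml => /andP[].
Qed.

(** The support condition concerns [closure Om], while the strip is defined from [Om]; the bounds
    pass to the closure because half-planes are closed. *)
Lemma closure_strip Om x w : bounded_domain Om -> closure Om w ->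
  strip_min Om x <= dot2 w x <= strip_max Om x.
Proof.
move=> bO Ow; apply/andP; split; last first.
  apply: (closure_le (@continuous_dot2 x)) Ow => v /(bounded_domain_dot2 x bO).
  by case/andP.
rewrite -lerN2; apply: (closure_le (h := fun y => - dot2 y x)) Ow => [y|v].
  by apply: cvgN; exact: continuous_dot2.
by move/(bounded_domain_dot2 x bO) => /andP[+ _]; rewrite lerN2.
Qed.

(** As [Om] is open, a point of it can be moved a little in direction [x], which strictly increases
    [dot2 w x]. *)
Lemma strip_min_lt_max Om x : unit_circle x -> bounded_domain Om ->
  strip_min Om x < strip_max Om x.
Proof.
move=> x1 bO; have [[w Ow] [oO _]] := bO.
have /nbhs_ballP[e /= e0 eO] : nbhs w Om by apply: open_nbhs_nbhs; split.
pose t := e / 2; have t0 : 0 < t by rewrite divr_gt0.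
have xi1 (r s : R) : r * r + s * s = 1 -> `|r| <= 1 /\ `|s| <= 1.
  by move=> rs; rewrite !ler_norml; split; nra.
have [h1 h2] := xi1 _ _ x1.
have small (u v : R) : `|v| <= 1 -> `|u - (u + t * v)| < e.
  move=> v1; rewrite opprD addNKr normrN normrM gtr0_norm//.
  apply: (@le_lt_trans _ _ t); first by rewrite ler_piMr// ltW.
  by rewrite /t; lra.
have Ot : Om (w.1 + t * x.1, w.2 + t * x.2) by apply: eO; split; exact: small.
have /andP[mw _] := bounded_domain_dot2 x bO Ow.
have /andP[_ wM] := bounded_domain_dot2 x bO Ot.
apply: le_lt_trans mw (lt_le_trans _ wM).
have -> : dot2 (w.1 + t * x.1, w.2 + t * x.2) x = dot2 w x + t * dot2 x x.
  by rewrite /dot2/=; ring.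
by rewrite x1 mulr1 ltrDl.
Qed.

Lemma Pi_line_strip Om x (alpha : R) :
  strip_min Om x <= - alpha <= strip_max Om x ->
  Pi_line x alpha `<=` strip_hull Om x.
Proof.
by move=> h y; rewrite /Pi_line /strip_hull/= => /eqP; rewrite addr_eq0 => /eqP ->.
Qed.

Variables (x : R * R) (F : R * R -> R[i] * R[i]) (Om : set (R * R)).
Hypothesis x1 : unit_circle x.
Hypothesis bO : bounded_domain Om.
Hypothesis supp : forall y, ~ closure Om y -> F y = (0, 0).

Lemma F_line_coord_eq0 (alpha t : R) :
  ~~ (strip_min Om x <= - alpha <= strip_max Om x) ->
  F (line_coord x (alpha, t)) = (0, 0).
Proof.
move=> h; apply: supp => /(closure_strip x bO); rewrite dot2C dot2_line_coord//.
exact/negP.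
Qed.

Lemma line_integral_dotc_eq0 (alpha : R) :
  ~~ (strip_min Om x <= - alpha <= strip_max Om x) ->
  line_integral x (Re_dotc x F) alpha = 0 /\ line_integral x (Im_dotc x F) alpha = 0.
Proof.
move=> h; split; rewrite /line_integral; under eq_Rintegral do
  rewrite (Re_dotcE, Im_dotcE) F_line_coord_eq0//= !mulr0 addr0.
- by rewrite Rintegral_cst// mul0r.
- by rewrite Rintegral_cst// mul0r.
Qed.

Lemma vL2_integrable_dotc_domain : vL2 F ->
  (@leb2 R).-integrable setT (EFin \o Re_dotc x F) /\
  (@leb2 R).-integrable setT (EFin \o Im_dotc x F).
Proof.
have [_ [_ [_ [M OM]]]] := bO => F2.
apply: (@vL2_integrable_dotc R x F M) => // y Fy.
apply: (closure_bounded OM); apply: contrapT => /supp Fy0.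
by rewrite Fy0 eqxx in Fy.
Qed.

End strips.

(** * Comparison of two sources *)

Section uniqueness.
Context {R : realType}.
Notation mu := (@lebesgue_measure R).

(** If the first strip stuck out of the second, an open interval of lines would lie in the first
    only. There [f_proj F2] is 0, so each line belongs to the null set of [neg1] or to the
    exceptional set of [f12]. *)
Lemma strip_le (x : R * R) (F1 F2 : R * R -> R[i] * R[i]) (Om1 Om2 : set (R * R)) :
  unit_circle x -> bounded_domain Om1 -> bounded_domain Om2 ->
  (forall y, ~ closure Om2 y -> F2 y = (0, 0)) ->
  mu.-negligible
    [set alpha | Pi_line x alpha `<=` strip_hull Om1 x /\ f_proj F1 x alpha = 0] ->
  {ae mu, forall alpha, f_proj F1 x alpha = f_proj F2 x alpha} ->
  strip_min Om2 x <= strip_min Om1 x /\ strip_max Om1 x <= strip_max Om2 x.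
Proof.
move=> x1 bO1 bO2 supp2 neg1 f12.
have no_gap (u v : R) : u < v -> (forall s, u < s < v ->
    (strip_min Om1 x <= s <= strip_max Om1 x) &&
    ~~ (strip_min Om2 x <= s <= strip_max Om2 x)) -> False.
  move=> uv gap.
  (* [Pi_line x alpha] sits at height [- alpha], so a gap between heights [u] and [v] is a reflected
     interval of parameters. *)
  have : mu.-negligible `]- v, - u[%classic.
    apply: negligibleS (negligibleU neg1 f12) => alpha /=; rewrite in_itv/= => /andP[h1 h2].
    have /andP[in1 out2] : (strip_min Om1 x <= - alpha <= strip_max Om1 x) &&
        ~~ (strip_min Om2 x <= - alpha <= strip_max Om2 x).
      by apply: gap; rewrite ltrNr h2/= ltrNl.
    have f2 : f_proj F2 x alpha = 0.
      have [P0 Q0] := line_integral_dotc_eq0 x1 bO2 supp2 out2.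
      by rewrite f_proj_line_integral P0 Q0.
    have [f1|f1] := pselect (f_proj F1 x alpha = f_proj F2 x alpha).
      by left; split; [exact: Pi_line_strip|rewrite f1].
    by right.
  have mI : measurable (`]- v, - u[%classic : set (measurableTypeR R)).
    exact: measurable_itv.
  move=> neg; have : mu `]- v, - u[%classic = 0%E := measure_negligible mI neg.
  rewrite lebesgue_measure_itv/= lte_fin ltrN2 uv opprK => /eqP.
  by rewrite -EFinD eqe; move: uv; lra.
have m1 := strip_min_lt_max x1 bO1.
split; rewrite leNgt; apply/negP => h.
(* The minimum keeps the gap inside the first strip even when the two strips are disjoint; [m1]
   makes it nonempty. *)
- apply: (no_gap (strip_min Om1 x) (Order.min (strip_min Om2 x) (strip_max Om1 x))).
    by rewrite lt_min h.
  move=> s /andP[s1]; rewrite lt_min => /andP[s2 s3].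
  by rewrite (ltW s1) (ltW s3)/= [strip_min Om2 x <= s]leNgt s2.
- apply: (no_gap (Order.max (strip_max Om2 x) (strip_min Om1 x)) (strip_max Om1 x)).
    by rewrite gt_max h.
  move=> s /andP[]; rewrite gt_max => /andP[s2 s3] s1.
  by rewrite (ltW s1) (ltW s3)/= [s <= strip_max Om2 x]leNgt s2 andbF.
Qed.

Lemma cexpi_neq0 (theta : R) : cexpi theta != 0.
Proof.
rewrite /cexpi realCDi eq_complex/=; apply/negP => /andP[/eqP c0 /eqP s0].
by have := cos2Dsin2 theta; rewrite c0 s0 expr0n/= addr0 => /eqP; rewrite eq_sym oner_eq0.
Qed.

(** The point source factor [e] is nonzero because [dot2 q x] is, so dividing by it reduces the data
    to [phase_retrieval]. *)
Lemma farfield_p_unique (lam mu_ omega : R) (tau1 tau2 tau3 : R[i])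
    (x q z : R * R) (F1 F2 : R * R -> R[i] * R[i]) :
  (forall a b : R,
    a%:C * (tau2 - tau1) + b%:C * (tau3 - tau1) = 0 -> a = 0 /\ b = 0) ->
  dot2 q x != 0 ->
  (forall tau, (tau = tau1 \/ tau = tau2 \/ tau = tau3) ->
    `| farfield_p_pt lam mu_ F1 z x q omega tau | =
    `| farfield_p_pt lam mu_ F2 z x q omega tau |) ->
  farfield_p lam mu_ F1 x omega = farfield_p lam mu_ F2 x omega.
Proof.
move=> ind qx data.
pose e := cexpi (- (kp lam mu_ omega * dot2 x z)) * (dot2 q x)%:C.
have e0 : e != 0 by rewrite mulf_neq0 ?cexpi_neq0// eq_complex/= eqxx andbT.
have eE F tau : farfield_p_pt lam mu_ F z x q omega tau
    = (farfield_p lam mu_ F x omega / e + tau) * e.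
  by rewrite /farfield_p_pt mulrDl divfK// /e mulrA.
have dataE tau : (tau = tau1 \/ tau = tau2 \/ tau = tau3) ->
    `|farfield_p lam mu_ F1 x omega / e + tau|
    = `|farfield_p lam mu_ F2 x omega / e + tau|.
  have n0 : `|e| != 0 by rewrite normr_eq0.
  by move=> /data; rewrite !eE 2!(normrM _ e) => /(mulIf n0).
apply: (mulIf (invr_neq0 e0)); apply: phase_retrieval ind _ _ _; apply: dataE; tauto.
Qed.

End uniqueness.

Theorem theorem3p5 (R : realType) (lam mu wmin wmax : R)
  (hmu : 0 < mu) (hlm : 0 < 2 * mu + lam) (hwmin : 0 < wmin) (hw : wmin < wmax)
  (tau1 tau2 tau3 : R[i])
  (htau12 : tau1 != tau2) (htau13 : tau1 != tau3) (htau23 : tau2 != tau3)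
  (htau_indep : forall a b : R,
      a%:C * (tau2 - tau1) + b%:C * (tau3 - tau1) = 0 -> a = 0 /\ b = 0)
  (x0 q0 z : R * R) (hx0 : unit_circle x0) (hq0 : unit_circle q0)
  (hq0x0 : dot2 q0 x0 != 0)
  (F1 F2 : R * R -> R[i] * R[i]) (Om1 Om2 : set (R * R))
  (hOm1 : bounded_domain Om1) (hOm2 : bounded_domain Om2)
  (hF1 : vL2 F1) (hF2 : vL2 F2)
  (hsupp1 : forall y, ~ closure Om1 y -> F1 y = (0, 0))
  (hsupp2 : forall y, ~ closure Om2 y -> F2 y = (0, 0))
  (hz1 : ~ closure Om1 z) (hz2 : ~ closure Om2 z)
  (hf1 : (@lebesgue_measure R).-negligible
           [set alpha | Pi_line x0 alpha `<=` strip_hull Om1 x0 /\ f_proj F1 x0 alpha = 0])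
  (hf2 : (@lebesgue_measure R).-negligible
           [set alpha | Pi_line x0 alpha `<=` strip_hull Om2 x0 /\ f_proj F2 x0 alpha = 0])
  (hdata : forall omega tau, wmin < omega < wmax -> (tau = tau1 \/ tau = tau2 \/ tau = tau3) ->
      `| farfield_p_pt lam mu F1 z x0 q0 omega tau | =
      `| farfield_p_pt lam mu F2 z x0 q0 omega tau |) :
  strip_hull Om1 x0 = strip_hull Om2 x0.
Proof.
have D0 : 0 < Num.sqrt (lam + 2 * mu) by rewrite sqrtr_gt0 addrC.
set D := Num.sqrt (lam + 2 * mu) in D0.
have [ip1 iq1] := vL2_integrable_dotc_domain x0 hOm1 hsupp1 hF1.
have [ip2 iq2] := vL2_integrable_dotc_domain x0 hOm2 hsupp2 hF2.
pose P1 := line_integral x0 (Re_dotc x0 F1); pose Q1 := line_integral x0 (Im_dotc x0 F1).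
pose P2 := line_integral x0 (Re_dotc x0 F2); pose Q2 := line_integral x0 (Im_dotc x0 F2).
have iP1 := integrable_line_integral hx0 ip1; have iQ1 := integrable_line_integral hx0 iq1.
have iP2 := integrable_line_integral hx0 ip2; have iQ2 := integrable_line_integral hx0 iq2.
(* A line whose parameter exceeds [M] in absolute value misses both strips. *)
pose M := `|strip_min Om1 x0| + `|strip_max Om1 x0| + `|strip_min Om2 x0| + `|strip_max Om2 x0|.
have far Om s : `|strip_min Om x0| + `|strip_max Om x0| < `|s| ->
    ~~ (strip_min Om x0 <= - s <= strip_max Om x0).
  apply: contraTN => /andP[h1 h2]; rewrite -leNgt ler_norml.
  have := ler_norm (strip_max Om x0); have := ler_norm (- strip_min Om x0).
  rewrite normrN; have := normr_ge0 (strip_max Om x0); have := normr_ge0 (strip_min Om x0).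
  by move: h1 h2; lra.
have far12 s : M < `|s| -> [/\ P1 s = 0, Q1 s = 0, P2 s = 0 & Q2 s = 0].
  rewrite /M => sM.
  have := normr_ge0 (strip_max Om1 x0); have := normr_ge0 (strip_min Om1 x0).
  have := normr_ge0 (strip_max Om2 x0); have := normr_ge0 (strip_min Om2 x0) => n1 n2 n3 n4.
  have [] := line_integral_dotc_eq0 hx0 hOm1 hsupp1 (far Om1 s _); first by lra.
  move=> p1 q1; have [] := line_integral_dotc_eq0 hx0 hOm2 hsupp2 (far Om2 s _); first by lra.
  by [].
have PQ0 : {ae @lebesgue_measure R, forall s, P1 s - P2 s = 0 /\ Q1 s - Q2 s = 0}.
  apply: (@frequency_band_ae_eq0 R _ _ (wmin / D) (wmax / D) M).
  - by rewrite ltr_pM2r ?invr_gt0.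
  - exact: (integrableB _ iP1 iP2).
  - exact: (integrableB _ iQ1 iQ2).
  - by move=> s /far12[-> _ -> _]; rewrite subr0.
  - by move=> s /far12[_ -> _ ->]; rewrite subr0.
  move=> k /andP[k1 k2].
  (* The wave number [k] is realized by the frequency [k * D], which lies in the measured band. *)
  have kE : kp lam mu (k * D) = k by rewrite /kp mulfK// gt_eqF.
  have kW : wmin < k * D < wmax by rewrite -ltr_pdivrMr// k1 -ltr_pdivlMr.
  have := farfield_p_unique htau_indep hq0x0 (fun tau => hdata (k * D) tau kW).
  rewrite (farfield_p_line_integral _ _ _ hx0 ip1 iq1).
  rewrite (farfield_p_line_integral _ _ _ hx0 ip2 iq2) kE => -[].
  rewrite -/P1 -/P2 -/Q1 -/Q2 => eRe eIm.
  have [cP1 sP1] := integrable_trigM k iP1; have [cP2 sP2] := integrable_trigM k iP2.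
  have [cQ1 sQ1] := integrable_trigM k iQ1; have [cQ2 sQ2] := integrable_trigM k iQ2.
  split.
  - transitivity (\int[@lebesgue_measure R]_s
       ((cos (k * s) * P1 s - sin (k * s) * Q1 s)
        - (cos (k * s) * P2 s - sin (k * s) * Q2 s))).
      by apply: eq_Rintegral => s _; ring.
    rewrite RintegralB ?eRe ?subrr//; [exact: (integrableB _ cP1 sQ1)|].
    exact: (integrableB _ cP2 sQ2).
  - transitivity (\int[@lebesgue_measure R]_s
       ((cos (k * s) * Q1 s + sin (k * s) * P1 s)
        - (cos (k * s) * Q2 s + sin (k * s) * P2 s))).
      by apply: eq_Rintegral => s _; ring.
    rewrite RintegralB ?eIm ?subrr//; [exact: (integrableD _ cQ1 sP1)|].
    exact: (integrableD _ cQ2 sP2).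
have f12 : {ae @lebesgue_measure R, forall s, f_proj F1 x0 s = f_proj F2 x0 s}.
  move: PQ0; apply: filterS; first exact: (ae_filter_ringOfSetsType lebesgue_measure).
  move=> s [/eqP + /eqP]; rewrite !subr_eq0 => /eqP Ps /eqP Qs.
  by rewrite !f_proj_line_integral -/P1 -/P2 -/Q1 -/Q2 Ps Qs.
have f21 : {ae @lebesgue_measure R, forall s, f_proj F2 x0 s = f_proj F1 x0 s}.
  by move: f12; apply: filterS; first exact: (ae_filter_ringOfSetsType lebesgue_measure).
have [m21 M12] := strip_le hx0 hOm1 hOm2 hsupp2 hf1 f12.
have [m12 M21] := strip_le hx0 hOm2 hOm1 hsupp1 hf2 f21.
have mE : strip_min Om1 x0 = strip_min Om2 x0 by apply/eqP; rewrite eq_le m12 m21.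
have ME : strip_max Om1 x0 = strip_max Om2 x0 by apply/eqP; rewrite eq_le M12 M21.
by rewrite /strip_hull -/(strip_min _ _) -/(strip_max _ _) mE ME.
Qed.
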